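(* For $i\in\{1,2\}$, let $k_i\in\mathbb{Z}^+$ and let $G_i$ be a finite $3k_i$-regular graph, with $G_1,G_2$ vertex-disjoint. Suppose $G_1$ and $G_2$ are 3-balanced. Then the join $G_1\nabla G_2$ is 3-balanced.
   Context: The join $G_1\nabla G_2$ of vertex-disjoint graphs is obtained from their disjoint union by adding all edges between a vertex of $G_1$ and a vertex of $G_2$. A graph is 3-balanced if it admits a vertex coloring $\ell:V\to\mathbb{Z}_3$ such that every vertex has, in its open neighborhood, the same number of vertices of each of the three colors. *)

(* Defs.v *)
From HB Require Import structures.
From mathcomp Require Import all_boot all_order all_algebra.

Set Implicit Arguments.
Unset Strict Implicit.
Unset Printing Implicit Defensive.

Record sgraph := SGraph {
  vertex :> finType;
  adj : rel vertex;
  adj_sym : symmetric adj;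
  adj_irr : irreflexive adj }.

Definition nbhd (G : sgraph) (v : G) : {set G} := [set u : G | adj v u].

Definition regular (d : nat) (G : sgraph) : Prop :=
  forall v : G, #|nbhd v| = d.

Definition balanced3 (G : sgraph) : Prop :=
  exists l : G -> 'Z_3, forall (v : G) (a b : 'Z_3),
    #|[set u in nbhd v | l u == a]| = #|[set u in nbhd v | l u == b]|.

(* Vertex-disjointness of the two graphs is built in: the vertex set of the
   join is the disjoint sum of the two vertex types. *)
Definition join_adj (G1 G2 : sgraph) : rel (G1 + G2)%type := fun u v =>
  match u, v with
  | inl u1, inl v1 => adj u1 v1
  | inr u2, inr v2 => adj u2 v2
  | _, _ => true
  end.

Lemma join_adj_sym (G1 G2 : sgraph) : symmetric (@join_adj G1 G2).
Proof. by move=> [u|u] [v|v] //=; apply: adj_sym. Qed.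

Lemma join_adj_irr (G1 G2 : sgraph) : irreflexive (@join_adj G1 G2).
Proof. by move=> [u|u] /=; apply: adj_irr. Qed.

Definition join (G1 G2 : sgraph) : sgraph :=
  SGraph (@join_adj_sym G1 G2) (@join_adj_irr G1 G2).

(* Main.v *)
(** Double counting the pairs (v, u) with u a neighbour of v of colour a shows
    that in a d-regular graph d * #|class a| is a sum, over v, of terms that do
    not depend on a when the colouring is balanced; so for d > 0 all colour
    classes have the same size. In the join, a vertex of one graph gains the
    whole vertex set of the other as neighbours, i.e. equally many vertices of
    each colour. *)
Require Import Defs.
From mathcomp Require Import all_boot all_order all_algebra.

Lemma sum_card_colored_nbhd (d : nat) (G : sgraph) (C : eqType) (l : G -> C)
    (a : C) :
  regular d G ->
  \sum_(v : G) #|[set u in nbhd v | l u == a]| = #|[set u | l u == a]| * d.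
Proof.
move=> reg; under eq_bigr => v _ do rewrite -sum1dep_card big_mkcond.
(* With the sums swapped, each [u] is compared separately: it should contribute [d] if its colour is
   [a], and 0 otherwise. *)
rewrite exchange_big -sum_nat_const [RHS]big_mkcond /=.
apply: eq_bigr => u _; rewrite !inE -(reg u).
under eq_bigr => v _ do rewrite inE.
case: (l u == a); last by rewrite big1 // => v _; rewrite andbF.
rewrite -sum1dep_card [RHS]big_mkcond /=.
(* By symmetry, the [v] having [u] as a neighbour are exactly the neighbours of [u]. *)
by apply: eq_bigr => v _; rewrite andbT adj_sym.
Qed.

Lemma balanced_color_classes (d : nat) (G : sgraph) (C : eqType) (l : G -> C)
    (a b : C) :
  0 < d -> regular d G ->
  (forall v, #|[set u in nbhd v | l u == a]|
             = #|[set u in nbhd v | l u == b]|) ->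
  #|[set u | l u == a]| = #|[set u | l u == b]|.
Proof.
move=> d_gt0 reg bal; apply/eqP; rewrite -(eqn_pmul2r d_gt0).
by rewrite -!sum_card_colored_nbhd //; apply/eqP/eq_bigr => v _.
Qed.

(** Used to split colour counts in the join by graph of origin. *)
Lemma card_set_sum (T1 T2 : finType) (P : pred (T1 + T2)) :
  #|[set x | P x]| = #|[set x | P (inl x)]| + #|[set x | P (inr x)]|.
Proof. by rewrite -!sum1dep_card big_sumType. Qed.

Theorem theorem6p6 (k1 k2 : nat) (G1 G2 : sgraph)
    (hk1 : 0 < k1) (hk2 : 0 < k2)
    (hreg1 : regular (3 * k1) G1) (hreg2 : regular (3 * k2) G2)
    (hbal1 : balanced3 G1) (hbal2 : balanced3 G2) :
  balanced3 (join G1 G2).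
Proof.
case: hbal1 => l1 bal1; case: hbal2 => l2 bal2.
pose l (x : join G1 G2) := match x with inl u => l1 u | inr u => l2 u end.
have class1 a b : #|[set u | l1 u == a]| = #|[set u | l1 u == b]|.
  by apply: (@balanced_color_classes (3 * k1)) => //; rewrite muln_gt0.
have class2 a b : #|[set u | l2 u == a]| = #|[set u | l2 u == b]|.
  by apply: (@balanced_color_classes (3 * k2)) => //; rewrite muln_gt0.
have nbhd1 v a : #|[set u in nbhd (inl v : join G1 G2) | l u == a]|
    = #|[set u in nbhd v | l1 u == a]| + #|[set u | l2 u == a]|.
  rewrite card_set_sum; congr (_ + _); apply: eq_card => u;
  by rewrite !inE.
have nbhd2 v a : #|[set u in nbhd (inr v : join G1 G2) | l u == a]|
    = #|[set u | l1 u == a]| + #|[set u in nbhd v | l2 u == a]|.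
  rewrite card_set_sum; congr (_ + _); apply: eq_card => u;
  by rewrite !inE.
exists l => -[v|v] a b.
  (* [bal1] handles the neighbours inside [G1], [class2] the added ones, which are all of [G2]. *)
  by rewrite !nbhd1 (bal1 v a b) (class2 a b).
by rewrite !nbhd2 (bal2 v a b) (class1 a b).
Qed.
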